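(* Let $(\mathcal A,\varphi,\mathcal F,\Phi)$ be a ncps of type B$'$ with associated infinitesimal ncps $(\mathcal B,\varphi,\varphi')$. Let $q\in\mathcal F$ satisfy $q^2=q$, $\Phi(q)=1$, and suppose $(\mathcal A,\{q\})$ is cyclic-antimonotone independent. Put $p:=1_{\mathcal B}-q$ and $\tilde a:=pap$ for $a\in\mathcal A$. Then for any $n\in\mathbb N$ and $a_1,\dots,a_n\in\mathcal A$, $$\varphi'(\tilde a_1\tilde a_2\cdots\tilde a_n)=-\sum_{\pi\in\mathrm{NC}(n)}|\mathrm{Kr}(\pi)|\,\kappa_\pi[a_1,a_2,\dots,a_n].$$
   Context: Ncps of type B$'$ $(\mathcal A,\varphi,\mathcal F,\Phi)$: $\mathcal A$ unital complex algebra, $\varphi:\mathcal A\to\mathbb C$ linear with $\varphi(1_{\mathcal A})=1$, $\mathcal F$ an algebra which is an $\mathcal A$-bimodule compatible with its multiplication, $\Phi:\mathcal F\to\mathbb C$ linear. $\mathcal B=\mathcal A\oplus\mathcal F$ with product $(a_1,f_1)(a_2,f_2)=(a_1a_2,a_1f_2+f_1a_2+f_1f_2)$ and unit $1_{\mathcal A}$; $\varphi(a+f):=\varphi(a)$, $\varphi'(a+f):=\Phi(f)$. $(\mathcal A,\{q\})$ cyclic-antimonotone independent means (with the subalgebra generated by $q$, which is $\mathbb Cq$) $\Phi(a_0qa_1q\cdots a_{n-1}qa_n)=\varphi(a_0a_n)\prod_{i=1}^{n-1}\varphi(a_i)\,\Phi(q)$ for all $n\ge1$, $a_l\in\mathcal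 A$. $\mathrm{NC}(n)$ is the lattice of noncrossing partitions of $\{1,\dots,n\}$; $\kappa_\pi$ are the free cumulants of $(\mathcal A,\varphi)$: multilinear maps defined by $\varphi(a_1\cdots a_n)=\sum_{\pi\in\mathrm{NC}(n)}\kappa_\pi[a_1,\dots,a_n]$ with $\kappa_\pi=\prod_{V\in\pi}\kappa_{|V|}$ applied to the arguments indexed by $V$ in increasing order. $\mathrm{Kr}(\pi)$ is the Kreweras complement of $\pi$ and $|\mathrm{Kr}(\pi)|$ its number of blocks, equal to $n+1-|\pi|$. *)

(* Defs.v *)
From HB Require Import structures.
From mathcomp Require Import all_boot all_order all_algebra.
From mathcomp Require Import complex.
From mathcomp Require Import reals.

Set Implicit Arguments.
Unset Strict Implicit.
Unset Printing Implicit Defensive.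

Import Order.TTheory GRing.Theory Num.Theory.
Local Open Scope ring_scope.

(* Noncommutative probability space of type B'  (A, phi, F, Phi).      *)
(* A is a unital C-algebra (algType C); F is a (possibly non-unital)   *)
(* C-algebra, given by its underlying C-vector space Fsp and a         *)
(* bilinear associative product mulF; F is a unital A-bimodule (actl,  *)
(* actr) compatible with mulF; phi : A -> C linear with phi 1 = 1 and  *)
(* Phi : F -> C linear.                                                *)
Record ncpsBp (C : fieldType) (A : algType C) := NcpsBp {
  Fsp : lmodType C;
  mulF : Fsp -> Fsp -> Fsp;
  actl : A -> Fsp -> Fsp;
  actr : Fsp -> A -> Fsp;
  phi : A -> C;
  Phi : Fsp -> C;
  mulFA : forall f g h, mulF f (mulF g h) = mulF (mulF f g) h;
  mulFDl : forall c f g h, mulF (c *: f + g) h = c *: mulF f h + mulF g h;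
  mulFDr : forall c f g h, mulF h (c *: f + g) = c *: mulF h f + mulF h g;
  actlDl : forall c a b f, actl (c *: a + b) f = c *: actl a f + actl b f;
  actlDr : forall c a f g, actl a (c *: f + g) = c *: actl a f + actl a g;
  actl1 : forall f, actl 1 f = f;
  actlM : forall a b f, actl (a * b) f = actl a (actl b f);
  actrDl : forall c a f g, actr (c *: f + g) a = c *: actr f a + actr g a;
  actrDr : forall c a b f, actr f (c *: a + b) = c *: actr f a + actr f b;
  actr1 : forall f, actr f 1 = f;
  actrM : forall a b f, actr f (a * b) = actr (actr f a) b;
  actlr : forall a b f, actr (actl a f) b = actl a (actr f b);
  actl_mulF : forall a f g, actl a (mulF f g) = mulF (actl a f) g;
  actr_mulF : forall a f g, actr (mulF f g) a = mulF f (actr g a);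
  mulF_act : forall a f g, mulF (actr f a) g = mulF f (actl a g);
  phi_lin : forall c a b, phi (c *: a + b) = c * phi a + phi b;
  phi1 : phi 1 = 1;
  Phi_lin : forall c f g, Phi (c *: f + g) = c * Phi f + Phi g
}.

Section AlgebraB.
Variables (C : fieldType) (A : algType C) (S : ncpsBp A).

Definition Bt := (A * Fsp S)%type.

Definition mulB (x y : Bt) : Bt :=
  (x.1 * y.1, actl x.1 y.2 + actr x.2 y.1 + mulF x.2 y.2).
Definition oneB : Bt := (1, 0).
Definition subB (x y : Bt) : Bt := (x.1 - y.1, x.2 - y.2).
Definition inA (a : A) : Bt := (a, 0).
Definition inF (f : Fsp S) : Bt := (0, f).
Definition prodB (s : seq Bt) : Bt := foldr mulB oneB s.

Definition phiB (x : Bt) : C := phi S x.1.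
Definition phi' (x : Bt) : C := Phi x.2.

Definition cyc_antimonotone (q : Fsp S) : Prop :=
  forall (n : nat) (a : nat -> A), (0 < n)%N ->
    phi' (prodB (inA (a 0%N) :: flatten [seq [:: inF q; inA (a i)] | i <- iota 1 n]))
    = phi S (a 0%N * a n) * (\prod_(1 <= i < n) phi S (a i)) * Phi q.

Definition pB (q : Fsp S) : Bt := subB oneB (inF q).
Definition tildeB (q : Fsp S) (a : A) : Bt := mulB (mulB (pB q) (inA a)) (pB q).

End AlgebraB.

Definition noncrossing (n : nat) (P : {set {set 'I_n}}) : bool :=
  [forall V in P, forall W in P, (V != W) ==>
    ~~ [exists a : 'I_n, exists b : 'I_n, exists c : 'I_n, exists d : 'I_n,
         [&& (a < b)%N, (b < c)%N, (c < d)%N,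
             a \in V, c \in V, b \in W & d \in W]]].

Definition NC (n : nat) : {set {set {set 'I_n}}} :=
  [set P : {set {set 'I_n}} | partition P [set: 'I_n] && noncrossing P].

Definition refines (n : nat) (tau sigma : {set {set 'I_n}}) : bool :=
  [forall W in tau, exists U in sigma, W \subset U].

(* interleaving 1 < 1' < 2 < 2' < ... < n < n' : i |-> 2i, i' |-> 2i+1 *)
Definition lftI (n : nat) (i : 'I_n) : 'I_(n.*2) :=
  Ordinal (etrans (ltn_double i n) (ltn_ord i)).
Definition rgtI (n : nat) (i : 'I_n) : 'I_(n.*2) :=
  Ordinal (etrans (ltn_Sdouble i n) (ltn_ord i)).

Definition interleave (n : nat) (P Q : {set {set 'I_n}}) : {set {set 'I_(n.*2)}} :=
  [set (@lftI n) @: V | V : {set 'I_n} in P] :|: [set (@rgtI n) @: W | W : {set 'I_n} in Q].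

Definition is_kreweras (n : nat) (pi sigma : {set {set 'I_n}}) : bool :=
  [&& sigma \in NC n, noncrossing (interleave pi sigma) &
      [forall tau in NC n, noncrossing (interleave pi tau) ==> refines tau sigma]].

Definition kreweras (n : nat) (pi : {set {set 'I_n}}) : {set {set 'I_n}} :=
  odflt set0 [pick sigma : {set {set 'I_n}} | is_kreweras pi sigma].

(* Free cumulants of (A, phi), defined by the moment-cumulant formula  *)
(*   phi(a_1 ... a_n) = sum_{pi in NC(n)} kappa_pi[a_1,...,a_n],       *)
(* i.e. recursively kappa_n = phi(a_1...a_n) - sum_{pi <> 1_n} kappa_pi *)
Section Cumulants.
Variables (C : fieldType) (A : algType C) (phi : A -> C).

Definition restr_seq (s : seq A) (V : {set 'I_(size s)}) : seq A :=
  [seq nth 0 s (val i) | i <- enum 'I_(size s) & i \in V].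

Fixpoint kappa_rec (k : nat) (s : seq A) : C :=
  match k with
  | 0 => 0
  | k'.+1 =>
      phi (\prod_(x <- s) x)
      - \sum_(P in NC (size s) | P != [set [set: 'I_(size s)]])
          \prod_(V in P) kappa_rec k' (restr_seq V)
  end.

Definition kappa (s : seq A) : C := kappa_rec (size s).+1 s.

Definition kappa_part (n : nat) (P : {set {set 'I_n}}) (a : 'I_n -> A) : C :=
  \prod_(V in P) kappa [seq a i | i <- enum 'I_n & i \in V].

End Cumulants.

(* Main.v *)
(* Since p^2 = p, the compressed product is p a_1 p a_2 ... a_n p. Expanding
   each p = 1 - q gives a signed sum over the sets J of gaps {0, ..., n} where q
   is placed. Cyclic-antimonotone independence evaluates the word of J as the
   product of the moments of the cells into which J cuts the circle of letters
   (the outer cell joins the two ends), and the moment-cumulant formula turns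
   this product into the sum of kappa_pi over the noncrossing pi that J does not
   cut. The sets J not cutting pi are those contained in a single block of
   Kr(pi), where the gaps 0 and n are identified; the alternating sum over the
   nonempty subsets of a nonempty set is -1, so kappa_pi gets the coefficient
   -|Kr(pi)|. *)
Require Import Defs.
From HB Require Import structures.
From mathcomp Require Import all_boot all_order all_algebra.
From mathcomp Require Import complex.
From mathcomp Require Import reals.
From mathcomp Require Import ssrAC.

Set Implicit Arguments.
Unset Strict Implicit.
Unset Printing Implicit Defensive.

Import Order.TTheory GRing.Theory Num.Theory.
Local Open Scope ring_scope.

(** * Noncrossing partitions and Kreweras complements *)

Lemma noncrossingP n (P : {set {set 'I_n}}) :
  reflect (forall V W (a b c d : 'I_n), V \in P -> W \in P ->
             (a < b)%N -> (b < c)%N -> (c < d)%N ->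
             a \in V -> c \in V -> b \in W -> d \in W -> V = W)
          (noncrossing P).
Proof.
apply: (iffP idP) => [ncP V W a b c d VP WP ab bc cd aV cV bW dW|ncP].
  apply/eqP; apply: contraT => neVW.
  move/forall_inP/(_ _ VP)/forall_inP/(_ _ WP)/implyP/(_ neVW)/negP: ncP; case.
  apply/existsP; exists a; apply/existsP; exists b.
  apply/existsP; exists c; apply/existsP; exists d.
  by rewrite ab bc cd aV cV bW dW.
apply/forall_inP => V VP; apply/forall_inP => W WP; apply/implyP => neVW.
apply/negP => /existsP[a /existsP[b /existsP[c /existsP[d]]]].
case/and5P => ab bc cd aV /and3P[cV bW dW].
by move/eqP: neVW; apply; apply: (ncP V W a b c d).
Qed.

Lemma partition_block n (P : {set {set 'I_n}}) (D V : {set 'I_n}) :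
  partition P D -> V \in P -> exists x, x \in V.
Proof. by move=> pP VP; apply/set0Pn/(partition_neq0 pP VP). Qed.

Lemma partition_uniq n (P : {set {set 'I_n}}) (D V W : {set 'I_n}) x :
  partition P D -> V \in P -> W \in P -> x \in V -> x \in W -> V = W.
Proof.
move=> /and3P[_ tP _] VP WP xV xW.
by rewrite -(def_pblock tP VP xV) (def_pblock tP WP xW).
Qed.

Lemma refines_anti n (P Q : {set {set 'I_n}}) (D : {set 'I_n}) :
  partition P D -> partition Q D -> refines P Q -> refines Q P -> P = Q.
Proof.
suff sub P' Q' : partition P' D -> partition Q' D -> refines P' Q' ->
    refines Q' P' -> P' \subset Q'.
  by move=> pP pQ PQ QP; apply/eqP; rewrite eqEsubset !sub.
move=> pP pQ PQ QP; apply/subsetP => V VP.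
have /exists_inP[U UQ VU] := forall_inP PQ _ VP.
have /exists_inP[V' V'P UV'] := forall_inP QP _ UQ.
have [x xV] := partition_block pP VP.
have eqV : V' = V.
  by apply: (partition_uniq pP V'P VP _ xV); apply/(subsetP UV')/(subsetP VU).
suff -> : V = U by [].
by apply/eqP; rewrite eqEsubset VU; rewrite eqV in UV'.
Qed.

Definition same_block n (P : {set {set 'I_n}}) (x y : 'I_n) :=
  [exists V in P, (x \in V) && (y \in V)].

Lemma same_blockP n (P : {set {set 'I_n}}) x y :
  reflect (exists V, [/\ V \in P, x \in V & y \in V]) (same_block P x y).
Proof.
apply: (iffP exists_inP) => [[V VP /andP[xV yV]]|[V [VP xV yV]]]; exists V => //.
by rewrite xV.
Qed.

(* The gaps of [0 < 1 < ... < n-1] are numbered 0, ..., n, the gap i lying just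
   before the point i. Cutting the circle at two gaps i and j splits no block
   of P exactly when i and j have the same separation profile. *)
Definition separated (i x y : nat) := (i <= x)%N (+) (i <= y)%N.

Lemma separatedE i x y :
  (x <= y)%N -> separated i x y = (x < i <= y)%N.
Proof.
by move=> xy; rewrite /separated; case: leqP => //= ix; rewrite (leq_trans ix xy).
Qed.

Lemma separatedC i x y : separated i x y = separated i y x.
Proof. exact: addbC. Qed.

(** For fixed [x] and [y], the gaps separating them form an interval. Its indicator cannot take
    alternating values at four increasing gaps. *)
Lemma separated_squeeze a b c d x y : (a <= b)%N -> (b <= c)%N -> (c <= d)%N ->
  separated a x y = separated c x y -> separated b x y = separated d x y ->
  separated a x y = separated b x y.
Proof.
have mono u v z : (u <= v)%N -> (v <= z)%N ==> (u <= z)%N.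
  by move=> uv; apply/implyP; apply: leq_trans.
move=> ab bc cd; move: (mono a b x ab) (mono b c x bc) (mono c d x cd).
move: (mono a b y ab) (mono b c y bc) (mono c d y cd); rewrite /separated.
by case: (a <= x)%N; case: (b <= x)%N; case: (c <= x)%N; case: (d <= x)%N;
  case: (a <= y)%N; case: (b <= y)%N; case: (c <= y)%N; case: (d <= y)%N.
Qed.

(** A finite function, so that profiles have decidable equality and can be counted. Pairs from
    different blocks get [false], so only cuts through blocks are recorded. *)
Definition gap_profile n (P : {set {set 'I_n}}) (i : nat) :
    {ffun 'I_n * 'I_n -> bool} :=
  [ffun xy => same_block P xy.1 xy.2 && separated i xy.1 xy.2].

Lemma gap_profileP n (P : {set {set 'I_n}}) i j :
  reflect (forall V x y, V \in P -> x \in V -> y \in V ->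
             separated i x y = separated j x y)
          (gap_profile P i == gap_profile P j).
Proof.
apply: (iffP eqP) => [/ffunP eqij V x y VP xV yV|eqij].
  move: (eqij (x, y)); rewrite !ffunE /=.
  by have -> : same_block P x y by apply/same_blockP; exists V.
apply/ffunP => -[x y]; rewrite !ffunE /=.
by case: same_blockP => //= -[V [VP xV yV]]; rewrite (eqij V).
Qed.

(** Gaps 0 and n are one gap of the circle: every point lies after the first and before the second,
    so neither separates anything. *)
Lemma gap_profile_last n (P : {set {set 'I_n}}) :
  gap_profile P n = gap_profile P 0.
Proof.
by apply/ffunP => -[x y]; rewrite !ffunE /separated /= ![(n <= _)%N]leqNgt !ltn_ord.
Qed.

(** An explicit form of the Kreweras complement: the interleaved point i' lies just after i, that
    is, in gap i+1. *)
Definition gap_partition n (P : {set {set 'I_n}}) :=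
  preim_partition (fun i : 'I_n => gap_profile P i.+1) [set: 'I_n].

Lemma gap_partition_eq n (P : {set {set 'I_n}}) V x y :
  V \in gap_partition P -> x \in V ->
  (y \in V) = (gap_profile P x.+1 == gap_profile P y.+1).
Proof.
case/imsetP => z _ -> /=; rewrite !inE /=.
by move/eqP->.
Qed.

Lemma gap_partitionP n (P : {set {set 'I_n}}) :
  partition (gap_partition P) [set: 'I_n].
Proof. exact: preim_partitionP. Qed.

Lemma card_gap_partition n (P : {set {set 'I_n}}) : (0 < n)%N ->
  #|gap_partition P| = #|[set gap_profile P i | i : 'I_n.+1]|.
Proof.
move=> n0.
set D := [set gap_profile P i | i : 'I_n.+1].
have DE : D = [set gap_profile P (i : 'I_n).+1 | i in [set: 'I_n]].
  apply/setP => v; apply/imsetP/imsetP => -[i _ ->]; last first.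
    by exists (lift ord0 i).
  case: (unliftP ord0 i) => [j ->|->]; first by exists j.
  have lt_n : (n.-1 < n)%N by rewrite prednK.
  (* Gap 0 has the profile of gap n, which is attained at the point n-1. *)
  exists (Ordinal lt_n); rewrite // -gap_profile_last; congr gap_profile.
  exact/esym/prednK.
(* The blocks are the fibres of the profile map; as every profile in [D] is attained, distinct
   profiles have distinct fibres. *)
have -> : gap_partition P =
    (fun v => [set y : 'I_n | v == gap_profile P y.+1]) @: D.
  by rewrite DE -imset_comp; apply: eq_imset => i /=; apply/setP => y; rewrite !inE.
rewrite card_in_imset // => u v /[!DE] /imsetP[i _ ->] /imsetP[j _ ->].
by move/setP/(_ i); rewrite !inE eqxx => /esym/eqP.
Qed.

Lemma gap_partition_nc n (P : {set {set 'I_n}}) : noncrossing (gap_partition P).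
Proof.
apply/noncrossingP => V W a b c d VK WK ab bc cd aV cV bW dW.
have := cV; rewrite (gap_partition_eq _ VK aV) => /gap_profileP ac.
have := dW; rewrite (gap_partition_eq _ WK bW) => /gap_profileP bd.
apply: (partition_uniq (gap_partitionP P) VK WK aV).
rewrite (gap_partition_eq _ WK bW); apply/gap_profileP => U x y UP xU yU.
apply/esym/(@separated_squeeze _ _ c.+1 d.+1); [exact: ltnW.. | |].
  exact: ac UP xU yU.
exact: bd UP xU yU.
Qed.

(** * Interleaved partitions and the Kreweras complement *)

Lemma lftI_neq_rgtI n (i j : 'I_n) : lftI i <> rgtI j.
Proof. by move/(congr1 (fun k : 'I_n.*2 => odd k)); rewrite /= !odd_double. Qed.

Lemma ltn_double_Sdouble i j : (i.*2 < j.*2.+1)%N = (i <= j)%N.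
Proof. by rewrite ltnS leq_double. Qed.

(** A block of P and a block of Q cross exactly when, for two points of the first, one gap given by
    the second separates them and another does not. *)
Lemma interleave_ncP n (P Q : {set {set 'I_n}}) :
    noncrossing P -> noncrossing Q ->
  reflect (forall V W (x y i j : 'I_n), V \in P -> W \in Q ->
             x \in V -> y \in V -> i \in W -> j \in W ->
             separated i.+1 x y = separated j.+1 x y)
          (noncrossing (interleave P Q)).
Proof.
move=> ncP ncQ; apply: (iffP (noncrossingP _)) => [nc|sat].
  move=> V W x y i j VP WQ xV yV iW jW.
  have VI : @lftI n @: V \in interleave P Q by rewrite inE imset_f.
  have WI : @rgtI n @: W \in interleave P Q by rewrite inE imset_f ?orbT.
  have L z : z \in V -> lftI z \in @lftI n @: V by move=> zV; apply: imset_f.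
  have G z : z \in W -> rgtI z \in @rgtI n @: W by move=> zV; apply: imset_f.
  have neq : @lftI n @: V <> @rgtI n @: W.
    move/setP/(_ (lftI x)); rewrite L // => /esym/imsetP[z _].
    exact: lftI_neq_rgtI.
  wlog ij : i j iW jW / (i <= j)%N.
    by move=> H; case: (leqP i j) => [/H->//|/ltnW/H->].
  wlog xy : x y xV yV / (x <= y)%N.
    move=> H; case: (leqP x y) => [/H->//|/ltnW/H].
    by rewrite ![separated _ y x]separatedC; apply.
  apply/eqP; apply: contraT => ne; case: neq; move: ne.
  rewrite !separatedE // !ltnS.
  case: (leqP x i) => [xi|ix] /=.
    rewrite (leq_trans xi ij) /=; case: (leqP y j) => [yj|jy]; last first.
      by rewrite (leq_ltn_trans ij jy).
    case: (ltnP i y) => // iy _.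
    by apply: (nc _ _ (lftI x) (rgtI i) (lftI y) (rgtI j));
      rewrite ?L ?G //= ?ltn_double_Sdouble ?ltn_Sdouble.
  case: (leqP x j) => //= xj; case: (ltnP j y) => // jy _.
  by apply/esym/(nc _ _ (rgtI i) (lftI x) (rgtI j) (lftI y));
    rewrite ?L ?G //= ?ltn_double_Sdouble ?ltn_Sdouble.
move=> V W a b c d; rewrite !inE.
(* Four cases, by the origin of the two blocks. In the mixed ones the crossing yields a separating
   and a non-separating gap, against [sat]. *)
move=> /orP[]/imsetP[V' V'P ->] /orP[]/imsetP[W' W'P ->] ab bc cd
  /imsetP[x xV eqa] /imsetP[z zV eqc] /imsetP[y yV eqb] /imsetP[t tV eqd];
  move: ab bc cd; rewrite {}eqa {}eqb {}eqc {}eqd /=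
    ?ltnS ?ltn_double ?leq_double ?ltn_Sdouble => ab bc cd.
- by rewrite (noncrossingP _ ncP V' W' x y z t).
- have := sat V' W' x z y t V'P W'P xV zV yV tV.
  rewrite !separatedE ?ltnS ?(leq_trans ab (ltnW bc)) //.
  by rewrite ab bc (leq_trans ab (leq_trans (ltnW bc) cd)) ltnNge cd.
- have := sat W' V' y t x z W'P V'P yV tV xV zV.
  rewrite !separatedE ?ltnS ?(leq_trans bc (ltnW cd)) //.
  by rewrite bc cd leqNgt ab.
- by rewrite (noncrossingP _ ncQ V' W' x y z t).
Qed.

(** By [interleave_ncP], a noncrossing partition is compatible with P iff profiles are constant on
    its blocks, i.e. iff it refines [gap_partition P]. The latter is thus the largest one, and a
    largest one is unique by antisymmetry of refinement. *)
Lemma kreweras_gap_partition n (P : {set {set 'I_n}}) :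
  P \in NC n -> kreweras P = gap_partition P.
Proof.
rewrite inE => /andP[pP ncP].
have pK := gap_partitionP P; have ncK := gap_partition_nc P.
have KNC : gap_partition P \in NC n by rewrite inE pK.
have ncPK : noncrossing (interleave P (gap_partition P)).
  apply/interleave_ncP => // V W x y i j VP WK xV yV iW.
  by rewrite (gap_partition_eq _ WK iW) => /gap_profileP; apply; eassumption.
have maxK tau : tau \in NC n -> noncrossing (interleave P tau) ->
    refines tau (gap_partition P).
  rewrite inE => /andP[pt nct] /interleave_ncP sat.
  apply/forall_inP => W Wt; have [i iW] := partition_block pt Wt.
  have : i \in cover (gap_partition P) by rewrite (cover_partition pK) inE.
  case/bigcupP => U UK iU; apply/exists_inP; exists U => //.
  apply/subsetP => j jW; rewrite (gap_partition_eq _ UK iU).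
  by apply/gap_profileP => V x y VP xV yV; apply: (sat _ _ V W).
rewrite /kreweras; case: pickP => [sigma|/(_ (gap_partition P))]; last first.
  rewrite /is_kreweras KNC ncPK /= => /negbT/negP[].
  by apply/forall_inP => tau tauNC; apply/implyP/maxK.
case/and3P => sNC ncs /forall_inP maxs /=.
have ps : partition sigma setT by move: sNC; rewrite inE => /andP[].
apply: (refines_anti ps pK); first exact: maxK.
by have /implyP := maxs _ KNC; apply.
Qed.

(** * Moments and free cumulants *)

Lemma partition_setT_full n (P : {set {set 'I_n}}) :
  partition P setT -> setT \in P -> P = [set setT].
Proof.
move=> pP TP; apply/setP => V; rewrite inE; apply/idP/eqP => [VP|->//].
have [x xV] := partition_block pP VP.
by apply: (partition_uniq pP VP TP xV).
Qed.

Lemma card_block_lt n (P : {set {set 'I_n}}) (V : {set 'I_n}) :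
  P \in NC n -> P != [set setT] -> V \in P -> (#|V| < n)%N.
Proof.
rewrite inE => /andP[pP _] Pn1 VP.
have leVn : (#|V| <= n)%N by rewrite -[leqRHS]card_ord max_card.
rewrite ltn_neqAle leVn andbT; apply: contraNneq Pn1 => cV.
apply/eqP/(partition_setT_full pP).
suff -> : [set: 'I_n] = V by [].
by apply/esym/eqP; rewrite eqEcard subsetT cardsT card_ord cV leqnn.
Qed.

Lemma full_partition_NC n : (0 < n)%N -> [set setT] \in NC n.
Proof.
move=> n0; rewrite inE; apply/andP; split; last first.
  by apply/noncrossingP => V W a b c d; rewrite !inE => /eqP-> /eqP->.
rewrite /partition /cover big_set1 eqxx /= inE.
apply/andP; split; first by apply/trivIsetP => V W /set1P-> /set1P->; rewrite eqxx.
by apply/negP => /eqP/setP/(_ (Ordinal n0)); rewrite !inE.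
Qed.

Lemma NC0 : NC 0 = [set set0].
Proof.
have T0 : [set: 'I_0] = set0 by apply/setP => -[].
apply/setP => P; rewrite !inE T0 partition_set0.
case: eqP => //= ->; apply/noncrossingP => V W a b c d.
by rewrite inE.
Qed.

(** * Transport of partitions along increasing maps *)

Lemma sorted_enum_ord n (V : {set 'I_n}) :
  sorted (relpre val ltn) [seq i <- enum 'I_n | i \in V].
Proof.
apply: sorted_filter; first by move=> x y z /= ; apply: ltn_trans.
by rewrite -sorted_map val_enum_ord iota_ltn_sorted.
Qed.

Lemma map_enum_imset n m (e : 'I_m -> 'I_n) (V : {set 'I_m}) :
    {homo e : i j / (i < j)%N} ->
  [seq i <- enum 'I_n | i \in e @: V] = [seq e i | i <- enum 'I_m & i \in V].
Proof.
move=> ehomo; apply: (@irr_sorted_eq _ (relpre val ltn)).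
- by move=> x y z /=; apply: ltn_trans.
- by move=> x /=; rewrite ltnn.
- exact: sorted_enum_ord.
- rewrite sorted_map; apply: sub_sorted (sorted_enum_ord V) => i j /=.
  exact: ehomo.
- move=> j; rewrite mem_filter mem_enum andbT; apply/imsetP/mapP => -[i iV ->].
    by exists i => //; rewrite mem_filter iV mem_enum.
  by move: iV; rewrite mem_filter => /andP[iV _]; exists i.
Qed.

Lemma homo_ord_inj n m (e : 'I_m -> 'I_n) :
  {homo e : i j / (i < j)%N} -> injective e.
Proof.
move=> ehomo i j eij; apply/val_inj.
by case: (ltngtP i j) => // /ehomo; rewrite eij ltnn.
Qed.

Lemma noncrossing_imset n m (e : 'I_m -> 'I_n) (P : {set {set 'I_m}}) :
    {homo e : i j / (i < j)%N} ->
  noncrossing [set e @: (V : {set 'I_m}) | V in P] = noncrossing P.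
Proof.
move=> ehomo; have einj := homo_ord_inj ehomo.
have emono i j : (e i < e j)%N -> (i < j)%N.
  case: (ltngtP i j) => // [/ehomo/ltnW|/val_inj->]; last by rewrite ltnn.
  by rewrite leqNgt => /negbTE->.
apply/noncrossingP/noncrossingP => nc V W a b c d.
  move=> VP WP ab bc cd aV cV bW dW; apply: (imset_inj einj).
  by apply: (nc _ _ (e a) (e b) (e c) (e d)); rewrite ?imset_f ?ehomo.
case/imsetP => V' V'P -> /imsetP[W' W'P ->] ab bc cd.
case/imsetP => x xV ea /imsetP[z zV ec] /imsetP[y yW eb] /imsetP[t tW ed].
by rewrite (nc V' W' x y z t) // emono // -?ea -?eb -?ec -?ed.
Qed.

Section MomentCumulant.
Variables (C : fieldType) (A : algType C) (phi : A -> C).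

Lemma size_restr_seq (s : seq A) (V : {set 'I_(size s)}) :
  size (restr_seq V) = #|V|.
Proof. by rewrite size_map cardE enumT. Qed.

Lemma restr_seqT (s : seq A) : restr_seq [set: 'I_(size s)] = s.
Proof.
rewrite /restr_seq (eq_filter (a2 := predT)); last by move=> i; rewrite inE.
rewrite filter_predT (map_comp (nth 0 s) val) val_enum_ord.
exact: mkseq_nth.
Qed.

(** The fuel does not matter once it exceeds the length: the recursion only visits blocks of
    partitions other than the full one, and these are strictly shorter. *)
Lemma kappa_rec_kappa k (s : seq A) :
  (size s < k)%N -> kappa_rec phi k s = kappa phi s.
Proof.
suff stable m : forall k k' (s : seq A), (size s < m)%N ->
    (size s < k)%N -> (size s < k')%N -> kappa_rec phi k s = kappa_rec phi k' s.
  by move=> sk; apply: (stable (size s).+1).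
elim: m => // m IH {}k k' {}s sm; case: k => // k sk; case: k' => // k' sk' /=.
congr (_ - _); apply: eq_bigr => P /andP[PNC Pn1]; apply: eq_bigr => V VP.
have lt_V : (size (restr_seq V) < size s)%N.
  by rewrite size_restr_seq (card_block_lt PNC).
by apply: IH; apply: leq_trans lt_V _; rewrite -ltnS.
Qed.

Hypothesis phi1 : phi 1 = 1.

Lemma moment_cumulant_seq (s : seq A) :
  phi (\prod_(x <- s) x)
  = \sum_(P in NC (size s)) \prod_(V in P) kappa phi (restr_seq V).
Proof.
case: (posnP (size s)) => [/size0nil->|s0].
  by rewrite big_nil phi1 [size [::]]/= NC0 big_set1 big_set0.
rewrite (bigD1 _ (full_partition_NC s0)) /= big_set1 restr_seqT {1}/kappa /=.
apply/eqP; rewrite -subr_eq; apply/eqP; congr (_ - _).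
apply: eq_bigr => P /andP[PNC Pn1]; apply: eq_bigr => V VP; apply/esym.
by apply: kappa_rec_kappa; rewrite size_restr_seq (card_block_lt PNC).
Qed.

Lemma moment_cumulant n (a : 'I_n -> A) :
  phi (\prod_(i < n) a i) = \sum_(P in NC n) kappa_part phi P a.
Proof.
pose s := [seq a i | i <- enum 'I_n].
have sz : size s = n by rewrite size_map size_enum_ord.
(* The length is generalized because [size s] occurs in the types of the partitions and cannot be
   rewritten there directly. *)
have gen m (H : size s = m) : phi (\prod_(x <- s) x) =
    \sum_(P in NC m) \prod_(V in P)
      kappa phi [seq nth 0 s (val i) | i <- enum 'I_m & i \in V].
  by case: m / H; apply: moment_cumulant_seq.
have -> : \prod_(i < n) a i = \prod_(x <- s) x by rewrite big_map enumT.
rewrite (gen n sz).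
apply: eq_bigr => P _; apply: eq_bigr => V _; congr kappa.
apply: eq_map => i; rewrite (nth_map i) ?size_enum_ord ?ltn_ord //.
by rewrite nth_ord_enum.
Qed.

(** The increasing enumeration [e] of B preserves the order of the factors and noncrossingness, so
    the formula on [#|B|] points carries over. *)
Lemma moment_cumulant_on n (a : 'I_n -> A) (B : {set 'I_n}) :
  phi (\prod_(i < n | i \in B) a i)
  = \sum_(P | partition P B && noncrossing P) kappa_part phi P a.
Proof.
pose e : 'I_#|B| -> 'I_n := enum_val.
have ehomo : {homo e : i j / (i < j)%N}.
  move=> i j ij; have x0 := e i.
  rewrite /e !(enum_val_nth x0).
  apply: (sorted_ltn_nth (leT := relpre val ltn)) => //.
  - by move=> x y z /=; apply: ltn_trans.
  - by have := sorted_enum_ord B; rewrite enumT.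
  - by rewrite inE -cardE.
  - by rewrite inE -cardE.
have einj := homo_ord_inj ehomo.
have eT : e @: setT = B.
  apply/setP => x; apply/imsetP/idP => [[i _ ->]|xB]; first exact: enum_valP.
  by exists (enum_rank_in xB x) => //; rewrite /e enum_rankK_in.
have -> : \prod_(i < n | i \in B) a i = \prod_(i < #|B|) a (e i).
  rewrite -big_filter -[in LHS]eT.
  transitivity (\prod_(i <- [seq i <- enum 'I_n | i \in e @: setT]) a i).
    by rewrite enumT.
  rewrite map_enum_imset // big_map enumT big_filter.
  by apply: eq_bigl => i; rewrite inE.
rewrite moment_cumulant.
pose h (P : {set {set 'I_#|B|}}) := [set e @: (V : {set 'I_#|B|}) | V in P].
have hinj : injective h by apply: imset_inj; apply: imset_inj.
transitivity (\sum_(P in h @: NC #|B|) kappa_part phi P a); last first.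
  apply: eq_bigl => P; apply/imsetP/andP => [[Q QNC ->]|[pP ncP]].
    move: QNC; rewrite inE => /andP[pQ ncQ].
    by rewrite -{1}eT imset_partition // noncrossing_imset.
  (* Every partition of B comes from the smaller index set, by pulling its blocks back along [e]. *)
  have Pim : P = h [set e @^-1: (V : {set 'I_n}) | V in P].
    rewrite /h -imset_comp -[LHS]imset_id; apply: eq_in_imset => V VP /=.
    apply/setP => x; apply/idP/imsetP => [xV|[y]]; last by rewrite inE => yV ->.
    have : x \in e @: setT by rewrite eT; apply: (subsetP (partitionS pP VP)).
    by case/imsetP => y _ xe; exists y; rewrite // inE -xe.
  exists [set e @^-1: (V : {set 'I_n}) | V in P] => //.
  by rewrite inE -(noncrossing_imset _ ehomo) -(imset_partition _ _ einj)
    -[imset _ _]/(h _) -Pim eT pP.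
rewrite big_imset /=; last by move=> P Q _ _; apply: hinj.
apply: eq_bigr => P _; rewrite /kappa_part big_imset /=; last first.
  by move=> V W _ _; apply: (imset_inj einj).
apply: eq_bigr => V _; congr kappa.
by rewrite map_enum_imset // -map_comp.
Qed.

(** Expanding each moment chooses a noncrossing partition of every cell. As the cells do not cross
    each other, the unions of such choices are exactly the noncrossing partitions whose blocks each
    stay within one cell. *)
Lemma prod_moments_cells n m (a : 'I_n -> A) (cell : 'I_n -> 'I_m) :
    (forall x y z t : 'I_n, (x < y)%N -> (y < z)%N -> (z < t)%N ->
       cell x = cell z -> cell y = cell t -> cell x = cell y) ->
  \prod_c phi (\prod_(i < n | cell i == c) a i)
  = \sum_(P in NC n | [forall V in P, forall x in V, forall y in V,
                          cell x == cell y]) kappa_part phi P a.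
Proof.
move=> nc_cell; pose B c := [set i | cell i == c].
have inB c x : (x \in B c) = (cell x == c) by rewrite inE.
transitivity (\prod_c \sum_(P | partition P (B c) && noncrossing P)
                 kappa_part phi P a).
  apply: eq_bigr => c _; rewrite -moment_cumulant_on; congr phi.
  by apply: eq_bigl => i; rewrite inE.
rewrite bigA_distr_big_dep.
pose h (f : {ffun 'I_m -> {set {set 'I_n}}}) := \bigcup_c f c.
pose h' (P : {set {set 'I_n}}) :=
  [ffun c => [set V in P | V \subset B c]] : {ffun 'I_m -> {set {set 'I_n}}}.
have constP (P : {set {set 'I_n}}) V x :
    [forall V in P, forall x in V, forall y in V, cell x == cell y] ->
    V \in P -> x \in V -> V \subset B (cell x).
  move=> /forall_inP cst VP xV; apply/subsetP => y yV; rewrite inB.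
  by have /forall_inP := forall_inP (cst V VP) y yV; apply.
(* [h] glues the partitions of the cells and [h'] sorts the blocks of P by cell. *)
rewrite [RHS](reindex_onto h h'); last first.
  move=> P /andP[]; rewrite inE => /andP[pP ncP] cst.
  apply/setP => V; apply/bigcupP/idP => [[c _]|VP]; rewrite ?ffunE ?inE.
    by case/andP.
  have [x xV] := partition_block pP VP.
  by exists (cell x); rewrite // ffunE inE VP (constP P).
have fam f : f \in family (fun c P => partition P (B c) && noncrossing P) ->
    forall c, partition (f c) (B c) /\ noncrossing (f c).
  by move=> /familyP ff c; have /andP := ff c.
have uniq_c f c d V : f \in family (fun c P => partition P (B c) && noncrossing P) ->
    V \in f c -> V \subset B d -> c = d.
  move=> ff Vc /subsetP VBd; have [pc _] := fam f ff c.
  have [x xV] := partition_block pc Vc.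
  have := subsetP (partitionS pc Vc) x xV; have := VBd x xV.
  by rewrite !inB => /eqP<- /eqP<-.
(* Blocks are nonempty, so the families [f c] are disjoint and the product over their union
   splits. *)
rewrite [LHS](eq_bigr (fun f => kappa_part phi (h f) a)); last first.
  move=> f ff; rewrite /kappa_part /h partition_disjoint_bigcup // => c d.
  apply: contraNT => /pred0Pn[V /andP[/= Vc Vd]]; apply/eqP.
  apply: (uniq_c f c d V) => //; have [pd _] := fam f ff d.
  exact: partitionS pd Vd.
apply: eq_bigl => f; apply/idP/idP => [ff|].
  have subB c V : V \in f c -> V \subset B c.
    by move=> Vc; have [pc _] := fam f ff c; apply: partitionS pc Vc.
  have cellE c V x : V \in f c -> x \in V -> cell x = c.
    by move=> /subB/subsetP VB /VB; rewrite inB => /eqP.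
  apply/andP; split; last first.
    apply/eqP/ffunP => c; rewrite ffunE; apply/setP => V; rewrite inE.
    apply/andP/idP => [[/bigcupP[d _ Vd]]|Vc].
      by move/(uniq_c f d c V ff Vd) => <-.
    by split; [apply/bigcupP; exists c | apply: subB].
  apply/andP; split; last first.
    apply/forall_inP => V /bigcupP[c _ Vc].
    apply/forall_inP => x xV; apply/forall_inP => y yV.
    by rewrite (cellE c V x) // (cellE c V y).
  rewrite inE; apply/andP; split.
    apply/and3P; split.
    - apply/eqP/setP => x; rewrite inE; apply/bigcupP.
      have [pc _] := fam f ff (cell x).
      have : x \in cover (f (cell x)) by rewrite (cover_partition pc) inB.
      case/bigcupP => V Vc xV; exists V => //.
      by apply/bigcupP; exists (cell x).
    - apply/trivIsetP => V W /bigcupP[c _ Vc] /bigcupP[d _ Wd].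
      apply: contraNT => /pred0Pn[x /andP[/= xV xW]]; apply/eqP.
      have cd : c = d by rewrite -(cellE c V x) // -(cellE d W x).
      rewrite -cd in Wd; have [pc _] := fam f ff c.
      exact: partition_uniq pc Vc Wd xV xW.
    - apply/negP => /bigcupP[c _]; have [pc _] := fam f ff c.
      by rewrite (partition0 pc).
  (* Crossing blocks must share a cell by [nc_cell], and inside a cell the chosen partition is
     noncrossing. *)
  apply/noncrossingP => V W x y z t /bigcupP[c _ Vc] /bigcupP[d _ Wd].
  move=> xy yz zt xV zV yW tW.
  have cd : c = d.
    rewrite -(cellE c V x) // -(cellE d W y) //.
    apply: (nc_cell x y z t) => //.
      by rewrite (cellE c V x) // (cellE c V z).
    by rewrite (cellE d W y) // (cellE d W t).
  rewrite -cd in Wd; have [_ /noncrossingP ncc] := fam f ff c.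
  exact: (ncc V W x y z t).
case/andP => /andP[]; rewrite inE; move: (h f) => P /andP[pP /noncrossingP ncP].
move=> cst /eqP <-; apply/familyP => c; rewrite ffunE; apply/andP; split.
  apply/and3P; split.
  - apply/eqP/setP => x; apply/bigcupP/idP => [[V]|xB].
      by rewrite inE => /andP[_ /subsetP]; apply.
    have : x \in cover P by rewrite (cover_partition pP) inE.
    case/bigcupP => V VP xV; exists V => //; rewrite inE VP.
    by move: xB; rewrite inB => /eqP <-; apply: constP cst VP xV.
  - apply: trivIsetS (partition_trivIset pP).
    by apply/subsetP => V; rewrite inE => /andP[].
  - by rewrite inE (partition0 pP).
apply/noncrossingP => V W x y z t; rewrite !inE => /andP[VP _] /andP[WP _].
exact: ncP.
Qed.

End MomentCumulant.

(** * Cutting at a set of gaps *)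

(** The sum is the expansion of a product of factors [F i + 1], with [F] equal to -1 on W and 0
    elsewhere; the factor at any point of W vanishes. *)
Lemma sum_sign_subset (R : comPzRingType) (I : finType) (W : {set I}) :
  W != set0 -> \sum_(J : {set I} | J \subset W) (-1) ^+ #|J| = 0 :> R.
Proof.
case/set0Pn => i0 i0W.
pose F i : R := if i \in W then -1 else 0.
transitivity (\prod_i (F i + 1)); last first.
  by rewrite (bigD1 i0) //= /F i0W addNr mul0r.
rewrite bigA_distr /= [LHS]big_mkcond /=; apply: eq_big => [J|J _].
  by rewrite inE.
rewrite -big_mkcond /=; case: ifP => [/subsetP sJW|/negbT].
  rewrite (eq_bigr (fun=> -1)) ?prodr_const // => i /sJW; rewrite /F.
  by move=> ->.
case/subsetPn => i iJ iW; rewrite (bigD1 i) //= {1}/F (negbTE iW) mul0r //.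
Qed.

(** A nonempty J with [D] constant lies in exactly one fibre. In each nonempty fibre the full
    alternating sum is 0 and the empty set accounts for 1, which leaves -1. *)
Lemma sum_sign_fibers (R : comPzRingType) (I T : finType) (D : I -> T) :
  \sum_(J : {set I} | (J != set0) && [forall i in J, forall j in J, D i == D j])
     (-1) ^+ #|J| = - #|[set D i | i : I]|%:R :> R.
Proof.
pose W v := [set i | D i == v].
transitivity (\sum_(v in [set D i | i : I])
    \sum_(J : {set I} | (J != set0) && (J \subset W v)) (-1) ^+ #|J| : R).
  rewrite (exchange_big_dep (fun J : {set I} =>
    (J != set0) && [forall i in J, forall j in J, D i == D j])) /=; last first.
    move=> v J _ /andP[-> /subsetP JW]; apply/forall_inP => i /JW.
    rewrite inE => /eqP ->; apply/forall_inP => j /JW; by rewrite inE eq_sym.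
  apply: eq_bigr => J /andP[J0 cst]; have /set0Pn[i iJ] := J0.
  rewrite (big_pred1 (D i)) // => v /=; rewrite J0 /=.
  apply/andP/eqP => [[_ /subsetP/(_ i iJ)]|->]; first by rewrite inE => /eqP.
  split; first by rewrite imset_f.
  apply/subsetP => j jJ; rewrite inE.
  by have /forall_inP := forall_inP cst j jJ; apply.
rewrite (eq_bigr (fun=> -1)) ?sumr_const ?mulNrn // => _ /imsetP[i _ ->].
have W0 : W (D i) != set0 by apply/set0Pn; exists i; rewrite inE.
have := sum_sign_subset R W0; rewrite (bigD1 set0) ?sub0set //= cards0 expr0.
move/eqP; rewrite addrC addr_eq0 => /eqP sumW.
rewrite -[RHS]sumW; apply: eq_bigl => J; exact: andbC.
Qed.

(** * Cells of the circle of letters *)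

Section GapCount.
Variable f : nat -> bool.

Definition gap_count m := (\sum_(j < m) f j)%N.

Lemma gap_count0 : gap_count 0 = 0%N.
Proof. exact: big_ord0. Qed.

Lemma gap_countS m : gap_count m.+1 = (gap_count m + f m)%N.
Proof. exact: big_ord_recr. Qed.

Lemma gap_count_homo : {homo gap_count : x y / (x <= y)%N}.
Proof.
move=> x y /subnKC <-; elim: (y - x)%N => [|d IH]; first by rewrite addn0.
by rewrite addnS gap_countS (leq_trans IH) // leq_addr.
Qed.

Lemma gap_count_lt i : f i -> (gap_count i < gap_count i.+1)%N.
Proof. by rewrite gap_countS => ->; rewrite addn1. Qed.

Lemma gap_count_const x y : (x <= y)%N ->
  (forall i, (x <= i < y)%N -> ~~ f i) -> gap_count x = gap_count y.
Proof.
move=> /subnKC <-; elim: (y - x)%N => [|d IH] nf; first by rewrite addn0.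
rewrite addnS gap_countS (negbTE (nf _ _)) ?addn0 ?leq_addr ?addnS ?ltnSn //.
by apply: IH => i /andP[xi id]; rewrite nf // xi addnS ltnS ltnW.
Qed.

End GapCount.

(** Among 0, ..., k reduction modulo k identifies only 0 with k: this is the joining of the two ends
    of the word. *)
Lemma eqn_mod_le a b k : (a <= b)%N -> (b <= k)%N -> (0 < k)%N ->
  (a %% k == b %% k)%N = (a == b) || (a == 0%N) && (b == k).
Proof.
move=> ab; rewrite leq_eqVlt => /orP[/eqP bk | bk] k0; last first.
  by rewrite !modn_small ?(leq_ltn_trans ab bk) // (ltn_eqF bk) andbF orbF.
rewrite {}bk in ab *; rewrite modnn eqxx andbT; case: (ltngtP a k) => [ak|ka|->].
- by rewrite modn_small.
- by rewrite ltnNge ab in ka.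
- by rewrite modnn.
Qed.

Section Cells.
Variables (n : nat) (J : {set 'I_n.+1}).
Hypothesis J0 : J != set0.

(** [inord] sends an index above n to gap 0, so the value is meaningful only for i at most n. *)
Definition cut (i : nat) := inord i \in J.

Lemma card_cut : gap_count cut n.+1 = #|J|.
Proof.
rewrite /gap_count -sum1_card [RHS]big_mkcond; apply: eq_bigr => i _.
by rewrite /cut inord_val; case: (i \in J).
Qed.

Lemma gap_count_cut_le (x : 'I_n) : (gap_count cut x.+1 <= #|J|)%N.
Proof. by rewrite -card_cut gap_count_homo // ltnW // ltnS. Qed.

Lemma card_cut_gt0 : (0 < #|J|)%N.
Proof. by rewrite card_gt0. Qed.

(** Counts the cuts at gaps 0, ..., x, those preceding the letter x. The modulus puts the letters
    after the last cut into the cell of those before the first. *)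
Definition cell (x : 'I_n) : 'I_#|J| :=
  Ordinal (ltn_pmod (gap_count cut x.+1) card_cut_gt0).

Lemma cell_eq (x y : 'I_n) : (x <= y)%N ->
  (cell x == cell y) = (gap_count cut x.+1 == gap_count cut y.+1)
    || (gap_count cut x.+1 == 0%N) && (gap_count cut y.+1 == #|J|).
Proof.
move=> xy; rewrite -val_eqE /= eqn_mod_le ?gap_count_cut_le ?card_cut_gt0 //.
exact: gap_count_homo.
Qed.

Lemma cell_noncrossing (x y z t : 'I_n) :
  (x < y)%N -> (y < z)%N -> (z < t)%N ->
  cell x = cell z -> cell y = cell t -> cell x = cell y.
Proof.
move=> xy yz zt /eqP + /eqP; rewrite !cell_eq ?(ltnW (ltn_trans xy yz)) //;
  last exact/ltnW/(ltn_trans yz zt).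
have cxy : (gap_count cut x.+1 <= gap_count cut y.+1)%N.
  by apply: gap_count_homo; rewrite ltnS ltnW.
have cyz : (gap_count cut y.+1 <= gap_count cut z.+1)%N.
  by apply: gap_count_homo; rewrite ltnS ltnW.
have czt : (gap_count cut z.+1 <= gap_count cut t.+1)%N.
  by apply: gap_count_homo; rewrite ltnS ltnW.
move=> xz yt; apply/eqP; rewrite cell_eq ?(ltnW xy) //.
case/orP: xz => [/eqP exz|/andP[/eqP x0 /eqP zJ]].
  by rewrite eqn_leq cxy exz cyz.
have tJ : gap_count cut t.+1 = #|J|.
  by apply/eqP; rewrite eqn_leq gap_count_cut_le -zJ.
case/orP: yt => [/eqP ->|/andP[/eqP -> _]]; first by rewrite x0 tJ !eqxx orbT.
by rewrite x0.
Qed.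

(** Two letters share a cell iff none of the cuts lies between them, or all of them do (the outer
    cell). *)
Lemma cell_eq_separated (x y : 'I_n) :
  reflect {in J &, forall i j : 'I_n.+1, separated i x y = separated j x y}
          (cell x == cell y).
Proof.
wlog xy : x y / (x <= y)%N.
  move=> H; case: (leqP x y) => [/H//|/ltnW/H{}H].
  by rewrite eq_sym; apply: (iffP H) => sep i j iJ jJ;
    have := sep i j iJ jJ; rewrite ![separated _ y x]separatedC.
rewrite cell_eq //; apply: (iffP idP) => [|sep].
  have cutJ i : i \in J -> cut i by rewrite /cut inord_val.
  case/orP => [/eqP exy|/andP[/eqP x0 /eqP yJ]].
    suff nsep i : i \in J -> separated i x y = false.
      by move=> i j /nsep -> /nsep ->.
    move=> /cutJ/gap_count_lt lt_i; rewrite separatedE //; apply/negP => /andP[xi iy].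
    have := gap_count_homo cut xi; rewrite exy leqNgt.
    by rewrite (leq_trans lt_i) // gap_count_homo.
  suff sep i : i \in J -> separated i x y by move=> i j /sep -> /sep ->.
  move=> /cutJ/gap_count_lt lt_i; rewrite separatedE //; apply/andP; split.
    rewrite ltnNge; apply/negP => ix; move: lt_i.
    by rewrite ltnNge (leq_trans (gap_count_homo cut (ix : i.+1 <= x.+1)%N)) // x0.
  rewrite leqNgt; apply/negP => yi; move: lt_i.
  rewrite ltnNge (leq_trans (gap_count_homo cut (ltn_ord i))) // card_cut -yJ.
  exact: gap_count_homo.
have inJ (i : nat) : (i <= n)%N -> cut i -> exists2 j : 'I_n.+1, j \in J & j = i :> nat.
  by move=> lein iJ; exists (inord i) => //; apply: inordK.
have len (z : 'I_n) : (z <= n)%N by rewrite ltnW.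
(* One cut [s] decides between the two cases, since all cuts behave alike. *)
have /set0Pn[s sJ] := J0; have := sep _ s _ sJ.
case: (separated s x y) => {}sep; last first.
  rewrite (gap_count_const (x := x.+1) (y := y.+1)) ?eqxx // => i /andP[xi iy].
  apply/negP => /inJ[]; first exact: leq_trans (iy : i <= y)%N (len y).
  by move=> j /sep; rewrite separatedE // => + ji; rewrite ji xi -ltnS iy.
(* All cuts lie between x and y: the count is still 0 at x and already [#|J|] at y. *)
apply/orP; right; apply/andP; split.
  rewrite -(gap_count_const (x := 0) (y := x.+1)) ?gap_count0 // => i /andP[_ ix].
  apply/negP => /inJ[]; first exact: leq_trans (ix : i <= x)%N (len x).
  by move=> j /sep; rewrite separatedE // => + ji; rewrite ji ltnNge -ltnS ix.
rewrite -card_cut (gap_count_const (x := y.+1) (y := n.+1)) ?eqxx ?ltnS //.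
move=> i /andP[yi iin]; apply/negP => /inJ[] //.
by move=> j /sep; rewrite separatedE // => + ji; rewrite ji (leqNgt i) yi andbF.
Qed.

(** The duality behind the count: both sides say that every pair of gaps in J treats every pair of
    points in a block of P alike. *)
Lemma cell_const_gap_profile (P : {set {set 'I_n}}) :
  [forall V in P, forall x in V, forall y in V, cell x == cell y]
  = [forall i in J, forall j in J, gap_profile P i == gap_profile P j].
Proof.
apply/forall_inP/forall_inP => [cst i iJ|cst V VP].
  apply/forall_inP => j jJ; apply/gap_profileP => V x y VP xV yV.
  have /forall_inP/(_ y yV)/cell_eq_separated := forall_inP (cst V VP) x xV.
  exact.
apply/forall_inP => x xV; apply/forall_inP => y yV.
apply/cell_eq_separated => i j iJ jJ.
have /forall_inP/(_ j jJ)/gap_profileP := cst i iJ; apply; eassumption.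
Qed.

End Cells.

(** * The ring [A + F] *)

(** Here cells are those of the line: the count is not reduced, so the two ends of the word are
    still separate. *)
Definition cell_prod (A : pzRingType) (f : nat -> bool) (b : nat -> A) m c : A :=
  \prod_(i < m) (if gap_count f i.+1 == c then b i else 1).

Lemma cell_prodS (A : pzRingType) f (b : nat -> A) m c :
  cell_prod f b m.+1 c
  = cell_prod f b m c * (if gap_count f m.+1 == c then b m else 1).
Proof. exact: big_ord_recr. Qed.

Lemma cell_prod1 (A : pzRingType) f (b : nat -> A) m c :
  (gap_count f m < c)%N -> cell_prod f b m c = 1.
Proof.
move=> ltc; rewrite /cell_prod big1 // => i _; rewrite ltn_eqF //.
by apply: leq_ltn_trans ltc; apply: gap_count_homo.
Qed.

(* No commutation is needed: every letter of cell 0 precedes every letter of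
   cell k. *)
Lemma cell_prod_ends (A : pzRingType) f (b : nat -> A) m k : (0 < k)%N ->
  (gap_count f m <= k)%N ->
  cell_prod f b m 0 * cell_prod f b m k
  = \prod_(i < m) (if (gap_count f i.+1 %% k == 0)%N then b i else 1).
Proof.
move=> k0; elim: m => [|m IH] lek; first by rewrite /cell_prod !big_ord0 mulr1.
have lemk : (gap_count f m <= k)%N.
  exact: leq_trans (gap_count_homo f (leqnSn m)) lek.
rewrite !cell_prodS big_ord_recr /= -IH //.
have -> : (gap_count f m.+1 %% k == 0)%N
    = (gap_count f m.+1 == 0)%N || (gap_count f m.+1 == k).
  move: lek; rewrite leq_eqVlt => /orP[/eqP ->|ltk].
    by rewrite modnn !eqxx orbT.
  by rewrite modn_small // (ltn_eqF ltk) orbF.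
case: eqP => [c0|_] /=; last by rewrite mulr1 mulrA.
have m0 : (gap_count f m < k)%N.
  apply: leq_ltn_trans (gap_count_homo f (leqnSn m)) _.
  by rewrite c0.
by rewrite c0 (ltn_eqF k0) (cell_prod1 _ m0) !mulr1.
Qed.

Lemma prod_if_opp (R : pzRingType) (I : finType) (J : {set I}) (F G : I -> R) :
  \prod_i (if i \in J then - F i else G i)
  = (-1) ^+ #|J| * \prod_i (if i \in J then F i else G i).
Proof.
have -> : #|J| = count (mem J) (index_enum I).
  by rewrite cardE size_filter.
elim: (index_enum I) => [|i r IH]; first by rewrite !big_nil mulr1.
rewrite !big_cons IH /=; case: (i \in J).
  by rewrite add1n exprS mulrA (commr_sign (- F i)) -[LHS]mulrA mulN1r !mulNr mulrN.
by rewrite add0n mulrA (commr_sign (G i)) -mulrA.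
Qed.

Section RingB.
Variables (C : fieldType) (A : algType C) (S : ncpsBp A).
Implicit Types (a b : A) (f g h : Fsp S).

Let mulFDl' f g h : mulF (f + g) h = mulF f h + mulF g h.
Proof. by rewrite -[f in LHS]scale1r mulFDl scale1r. Qed.
Let mulFDr' f g h : mulF h (f + g) = mulF h f + mulF h g.
Proof. by rewrite -[f in LHS]scale1r mulFDr scale1r. Qed.
Let actlDl' a b f : actl (a + b) f = actl a f + actl b f.
Proof. by rewrite -[a in LHS]scale1r actlDl scale1r. Qed.
Let actlDr' a f g : actl a (f + g) = actl a f + actl a g.
Proof. by rewrite -[f in LHS]scale1r actlDr scale1r. Qed.
Let actrDl' a f g : actr (f + g) a = actr f a + actr g a.
Proof. by rewrite -[f in LHS]scale1r actrDl scale1r. Qed.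
Let actrDr' a b f : actr f (a + b) = actr f a + actr f b.
Proof. by rewrite -[a in LHS]scale1r actrDr scale1r. Qed.

Let actl0 a : actl a 0 = 0 :> Fsp S.
Proof. by apply: (addrI (actl a 0)); rewrite -actlDr' !addr0. Qed.
Let actr0 a : actr 0 a = 0 :> Fsp S.
Proof. by apply: (addrI (actr 0 a)); rewrite -actrDl' !addr0. Qed.
Let mul0F f : mulF 0 f = 0.
Proof. by apply: (addrI (mulF 0 f)); rewrite -mulFDl' !addr0. Qed.
Let mulF0 f : mulF f 0 = 0.
Proof. by apply: (addrI (mulF f 0)); rewrite -mulFDr' !addr0. Qed.

Let mulBA : associative (@mulB C A S).
Proof.
move=> [a1 f1] [a2 f2] [a3 f3]; congr pair => /=; first exact: mulrA.
rewrite !mulFDl' !mulFDr' !actlDr' !actrDl' actlM actrM actlr.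
rewrite actl_mulF actr_mulF mulF_act mulFA !addrA.
by rewrite [RHS](ACl (1*2*5*3*6*4*7)).
Qed.

Let mul1B : left_id (@oneB C A S) (@mulB C A S).
Proof.
by move=> [a f]; rewrite /mulB /= mul1r actl1 actr0 mul0F !addr0.
Qed.

Let mulB1 : right_id (@oneB C A S) (@mulB C A S).
Proof.
by move=> [a f]; rewrite /mulB /= mulr1 actl0 actr1 mulF0 addr0 add0r.
Qed.

Let mulBDl : left_distributive (@mulB C A S) (fun x y => (x.1 + y.1, x.2 + y.2)).
Proof.
move=> [a1 f1] [a2 f2] [a3 f3]; rewrite /mulB /= mulrDl; congr pair.
rewrite mulFDl' actlDl' actrDl' !addrA.
by rewrite [LHS](ACl (1*3*5*2*4*6)).
Qed.

Let mulBDr : right_distributive (@mulB C A S) (fun x y => (x.1 + y.1, x.2 + y.2)).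
Proof.
move=> [a1 f1] [a2 f2] [a3 f3]; rewrite /mulB /= mulrDr; congr pair.
rewrite mulFDr' actlDr' actrDr' !addrA.
by rewrite [LHS](ACl (1*3*5*2*4*6)).
Qed.

Definition Bring := Bt S.
HB.instance Definition _ := GRing.Zmodule.copy Bring (A * Fsp S)%type.
HB.instance Definition _ :=
  GRing.Zmodule_isPzRing.Build Bring mulBA mul1B mulB1 mulBDl mulBDr.

Definition iota_A : A -> Bring := @inA C A S.

Lemma iota_AM a b : iota_A (a * b) = iota_A a * iota_A b.
Proof. by congr pair; rewrite /= actl0 actr0 mul0F !addr0. Qed.

Lemma iota_A1 : iota_A 1 = 1.
Proof. by []. Qed.

Lemma prodBE (s : seq Bring) : prodB s = \prod_(x <- s) x.
Proof.
by elim: s => [|x s IH]; rewrite ?big_nil ?big_cons //= IH.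
Qed.

Lemma phi'D (x y : Bring) : phi' (x + y) = phi' x + phi' y.
Proof. by rewrite /phi' /= -[x.2]scale1r Phi_lin mul1r scale1r. Qed.

Lemma phi'0 : phi' (0 : Bring) = 0.
Proof. by apply: (addrI (phi' (0 : Bring))); rewrite -phi'D !addr0. Qed.

Lemma phi'N (x : Bring) : phi' (- x) = - phi' x.
Proof. by apply/eqP; rewrite -addr_eq0 -phi'D addNr phi'0. Qed.

Lemma phi'_sum (I : Type) (r : seq I) (P : pred I) (F : I -> Bring) :
  phi' (\sum_(i <- r | P i) F i) = \sum_(i <- r | P i) phi' (F i).
Proof. exact: (big_morph (@phi' C A S) phi'D phi'0). Qed.

Lemma phi'_sign k (x : Bring) : phi' ((-1) ^+ k * x) = (-1) ^+ k * phi' x.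
Proof.
by rewrite -signr_odd -[in RHS]signr_odd; case: odd;
  rewrite ?expr1 ?expr0 ?mulN1r ?mul1r ?phi'N.
Qed.

Lemma phi'_iota_A a : phi' (iota_A a) = 0.
Proof. exact: phi'0. Qed.

Variable q : Fsp S.
Let Q : Bring := inF q.

Lemma cyc_antimonotoneE : cyc_antimonotone q ->
  forall (n : nat) (a : nat -> A), (0 < n)%N ->
    phi' (iota_A (a 0%N) * \prod_(1 <= i < n.+1) (Q * iota_A (a i)))
    = phi S (a 0%N * a n) * (\prod_(1 <= i < n) phi S (a i)) * Phi q.
Proof.
move=> cyc n a n0; rewrite -cyc // prodBE big_cons; congr phi'; congr (_ * _ : Bring).
rewrite big_flatten /= big_map /index_iota subSS subn0.
by apply: eq_bigr => i _; rewrite !big_cons big_nil mulr1.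
Qed.

Hypothesis QQ : Q * Q = Q.
Let p : Bring := 1 - Q.

Let pp : p * p = p.
Proof. by rewrite /p mulrBl mul1r mulrBr mulr1 QQ subrr subr0. Qed.

Let tildeE a : tildeB q a = p * iota_A a * p.
Proof. by []. Qed.

(** Neighbouring copies of p merge because [p * p = p]. A nonempty product already begins and ends
    with p, so outer copies can be added freely. *)
Lemma prod_tildeB (s : seq A) : s != [::] ->
  prodB [seq tildeB q a | a <- s] = (\prod_(a <- s) (p * iota_A a)) * p.
Proof.
move=> s0; rewrite prodBE big_map.
have pTp (t : seq A) : p * (\prod_(a <- t) (tildeB q a : Bring)) * p =
    (\prod_(a <- t) (p * iota_A a)) * p.
  elim: t => [|a t IH]; first by rewrite !big_nil mulr1 pp mul1r.
  by rewrite !big_cons tildeE -mulrA -[RHS]mulrA -IH !mulrA pp.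
rewrite -pTp; case: s s0 => // a s _.
have -> : p * \prod_(b <- a :: s) (tildeB q b : Bring) =
    \prod_(b <- a :: s) (tildeB q b : Bring).
  by rewrite big_cons tildeE !mulrA pp.
elim: s a => [|b s IH] a; first by rewrite big_seq1 tildeE -[RHS]mulrA pp.
by rewrite big_cons -[RHS]mulrA -IH.
Qed.

(** Collects the letters between consecutive q into one element of A, giving the alternating form to
    which independence applies. *)
Lemma word_cells (f : nat -> bool) (b : nat -> A) m :
  \prod_(i < m) (if f i then Q * iota_A (b i) else iota_A (b i))
  = iota_A (cell_prod f b m 0)
    * \prod_(1 <= c < (gap_count f m).+1) (Q * iota_A (cell_prod f b m c)).
Proof.
elim: m => [|m IH].
  by rewrite /cell_prod !big_ord0 gap_count0 big_geq // iota_A1 mulr1.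
rewrite big_ord_recr IH /= {IH}.
have old c : (c < gap_count f m.+1)%N -> cell_prod f b m.+1 c = cell_prod f b m c.
  by move=> ltc; rewrite cell_prodS gtn_eqF // mulr1.
have new : cell_prod f b m.+1 (gap_count f m.+1)
    = cell_prod f b m (gap_count f m.+1) * b m.
  by rewrite cell_prodS eqxx.
have oldprod k : (k <= gap_count f m.+1)%N ->
    \prod_(1 <= c < k) (Q * iota_A (cell_prod f b m.+1 c)) =
    \prod_(1 <= c < k) (Q * iota_A (cell_prod f b m c)).
  by move=> lek; apply: eq_big_nat => c /andP[_ ck]; rewrite old // (leq_trans ck).
(* A new q opens a cell consisting of the new letter; otherwise the letter extends the last cell,
   which is the leading factor if no q has occurred yet. *)
move: old new oldprod; rewrite gap_countS; case: (f m); rewrite ?addn1 ?addn0.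
  move=> old new oldprod; rewrite [in RHS]big_nat_recr //= oldprod // old //.
  by rewrite new (cell_prod1 b (ltnSn (gap_count f m))) mul1r; apply/esym/mulrA.
case k : (gap_count f m) => [|k'] old new oldprod.
  by rewrite !big_geq // !mulr1 new iota_AM.
rewrite [in LHS]big_nat_recr //= [in RHS]big_nat_recr //= oldprod // old // new.
by rewrite iota_AM !mulrA.
Qed.

End RingB.

(** * Expansion of the compressed product *)

Section Compression.
Variables (C : fieldType) (A : algType C) (S : ncpsBp A) (q : Fsp S).
Hypotheses (qq : mulB (inF q) (inF q) = inF q) (Phiq : Phi q = 1).
Hypothesis cyc : cyc_antimonotone q.
Variables (n : nat) (a : 'I_n -> A).

(** The letters, padded with 1 from index n on, so that the closing p also carries a letter and the
    n+1 gaps are treated uniformly. *)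
Let b (i : nat) : A := oapp a 1 (insub i).

Let bE (i : 'I_n) : b i = a i.
Proof. by rewrite /b valK. Qed.

Let bn : b n = 1.
Proof. by rewrite /b insubF // ltnn. Qed.

Let letter (J : {set 'I_n.+1}) (i : 'I_n.+1) : Bring S :=
  if i \in J then (inF q : Bring S) * iota_A S (b i) else iota_A S (b i).

Lemma phi'_word (J : {set 'I_n.+1}) (J0 : J != set0) :
  phi' (\prod_i letter J i)
  = \prod_c phi S (\prod_(i < n | cell J0 i == c) a i).
Proof.
have -> : \prod_i letter J i = \prod_(i < n.+1)
    (if cut J i then (inF q : Bring S) * iota_A S (b i) else iota_A S (b i)).
  by apply: eq_bigr => i _; rewrite /cut inord_val.
have k0 : (0 < #|J|)%N by rewrite card_gt0.
rewrite word_cells card_cut (cyc_antimonotoneE cyc) // Phiq mulr1.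
have cpn c : cell_prod (cut J) b n.+1 c = cell_prod (cut J) b n c.
  by rewrite cell_prodS bn; case: ifP; rewrite mulr1.
have lenJ : (gap_count (cut J) n <= #|J|)%N by rewrite -card_cut gap_count_homo.
(* Independence joins the first and last cells under one [phi]; together they form the cell of
   residue 0. *)
rewrite !cpn cell_prod_ends //.
pose G c := phi S (\prod_(i < n)
  (if (gap_count (cut J) i.+1 %% #|J| == c)%N then b i else 1)).
transitivity (\prod_(0 <= c < #|J|) G c); last first.
  rewrite big_mkord; apply: eq_bigr => c _; rewrite /G [in RHS]big_mkcond.
  by congr (phi S _); apply: eq_bigr => i _; rewrite bE.
(* For the inner cells, with c strictly between 0 and [#|J|], reducing the count changes nothing. *)
rewrite [RHS]big_ltn //; congr (_ * _); apply: eq_big_nat => c /andP[c0 cJ].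
rewrite cpn /G; congr (phi S _); apply: eq_bigr => i _.
have := gap_count_cut_le J i; rewrite leq_eqVlt => /orP[/eqP ->|ltJ].
  by rewrite modnn (gtn_eqF cJ) (ltn_eqF c0).
by rewrite modn_small.
Qed.

Lemma phi'_prod_tildeB : (0 < n)%N ->
  phi' (prodB [seq tildeB q (a i) | i <- enum 'I_n])
  = \sum_(J : {set 'I_n.+1}) (-1) ^+ #|J| * phi' (\prod_i letter J i).
Proof.
move=> n0; rewrite (map_comp (tildeB q) a) prod_tildeB //; last first.
  by rewrite -size_eq0 size_map size_enum_ord -lt0n.
pose p : Bring S := 1 - (inF q : Bring S).
transitivity (phi' (\prod_(i < n.+1) (p * iota_A S (b i)))).
  rewrite big_ord_recr /= bn iota_A1 mulr1 big_map enumT; congr (phi' (mulB _ _)).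
  by apply: eq_bigr => i _; rewrite bE.
(* Distributing over these two terms, J records the gaps where the term with q is taken, each with a
   sign. *)
rewrite (eq_bigr (fun i : 'I_n.+1 => - ((inF q : Bring S) * iota_A S (b i)) +
  iota_A S (b i))); last by move=> i _; rewrite mulrBl mul1r addrC.
rewrite bigA_distr /= phi'_sum; apply: eq_big => [J|J _]; first by rewrite inE.
by rewrite -phi'_sign -prod_if_opp.
Qed.

Lemma phi'_compression : (0 < n)%N ->
  phi' (prodB [seq tildeB q (a i) | i <- enum 'I_n])
  = - \sum_(P in NC n) (#|kreweras P|)%:R * kappa_part (phi S) P a.
Proof.
move=> n0; rewrite phi'_prod_tildeB //.
(* The word of the empty J lies in A, where [phi'] vanishes. *)
rewrite (bigD1 set0) //= {1}/letter.
under eq_bigr => i _ do rewrite inE.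
have -> : \prod_(i < n.+1) iota_A S (b i) = iota_A S (\prod_(i < n.+1) b i).
  by rewrite (big_morph (iota_A S) (iota_AM S) (iota_A1 S)).
rewrite phi'_iota_A mulr0 add0r.
pose compat (J : {set 'I_n.+1}) (P : {set {set 'I_n}}) :=
  [forall i in J, forall j in J, gap_profile P i == gap_profile P j].
transitivity (\sum_(J : {set 'I_n.+1} | J != set0) \sum_(P in NC n | compat J P)
    (-1) ^+ #|J| * kappa_part (phi S) P a).
  apply: eq_bigr => J J0; rewrite -mulr_sumr phi'_word prod_moments_cells.
  - by congr (_ * _); apply: eq_bigl => P; rewrite cell_const_gap_profile.
  - exact: phi1.
  - exact: cell_noncrossing.
(* With P outside, its coefficient is an alternating sum over the J of constant profile: minus the
   number of profiles, i.e. of blocks of the Kreweras complement. *)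
rewrite (exchange_big_dep (fun P => P \in NC n)) /=; last by move=> J P _ /andP[].
rewrite -sumrN; apply: eq_bigr => P PNC; rewrite -mulr_suml -mulNr.
rewrite kreweras_gap_partition // card_gap_partition // -sum_sign_fibers.
by congr (_ * _); apply: eq_bigl => J; rewrite PNC.
Qed.

End Compression.

Theorem theorem5p1 (R : realType) (A : algType R[i]) (S : ncpsBp A)
  (q : Fsp S) :
  mulB (inF q) (inF q) = inF q ->
  Phi q = 1 ->
  cyc_antimonotone q ->
  forall (n : nat) (a : 'I_n -> A), (0 < n)%N ->
    phi' (prodB [seq tildeB q (a i) | i <- enum 'I_n])
    = - \sum_(P in NC n) (#|kreweras P|)%:R * kappa_part (phi S) P a.
Proof. by move=> qq Phiq cyc n a; apply: phi'_compression. Qed.
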